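(* Given an $\alpha$-competitive algorithm for the $k$-server problem on a metric space $\mathbf{S}$, we can construct an $O(k\alpha)$-competitive algorithm for the online ball search problem on $\mathbf{S}$, i.e., its total radius searched (number of steps of $\mathcal{A}$ executed) is at most $O(k\alpha)$ times the cost of any collection of $k$ trajectories.
   Context: Online ball search: $\mathbf{S}$ is a metric space with metric $d$ and fixed starting point $\mathbf{0}$. On each day $t=1,\dots,T$ an instance $I_t$ arrives with unknown true solution $S_t\in\mathbf{S}$, which must be output. A warm start algorithm $\mathcal{A}$ is available: for any $P\in\mathbf{S}$, $\mathcal{A}(I_t,P)$ outputs $S_t$ within at most $d(S_t,P)$ steps; the algorithm may run any number of such searches (interleaved), and its cost is the total number of steps of $\mathcal{A}$ executed (total radius searched). A collection of $k$ trajectories is a partition of $[T]$ into $\mathcal{T}^{(1)},\dots,\mathcal{T}^{(k)}$ together with predictions $P_t\in\mathbf{S}$; for $t\in\mathcal{T}^{(i)}$ let $\mathrm{prev}^{(i)}(t)$ be the previous day in $\mathcal{T}^{(i)}$ (with $P_{\mathrm{prev}}=\mathbf{0}$ if none); its cost is $\sum_{i}\sum_{t\in\mathcal{T}^{(i)}}\big[d(P_t,S_t)+d(P_{\mathrm{prev}^{(i)}(t)},P_t)\big]$. In the $k$-server problem, $k$ servers in $\mathbf{S}$ must be moved so that on each day $t$ some server is at the request $r_t$; cost is the total movement; an online $k$-server algorithm is $\alpha$-competitive if its cost is at most $\alpha$ times the optimal offline cost for every request sequence. *)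

(* Defs.v *)
From mathcomp Require Import all_boot all_order all_algebra.
From mathcomp Require Import all_classical all_reals all_analysis.

Set Implicit Arguments.
Unset Strict Implicit.
Unset Printing Implicit Defensive.

Import Order.TTheory GRing.Theory Num.Theory.

Local Open Scope classical_set_scope.
Local Open Scope ring_scope.

(* Days are numbered from 0: a horizon T concerns the days t < T, and the
   values at t >= T of a sequence indexed by nat play no role. *)

Section KServer.
Variables (R : realType) (S : metricType R) (k : nat) (o : S).

(* c t i is the position of server i before request r t is served, and
   c t.+1 i its position afterwards; all servers start at o. *)
Definition serves (r : nat -> S) (T : nat) (c : nat -> 'I_k -> S) : Prop :=
  (forall i, c 0%N i = o) /\
  (forall t, (t < T)%N -> exists i, c t.+1 i = r t).

Definition movement (T : nat) (c : nat -> 'I_k -> S) : R :=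
  \sum_(t < T) \sum_(i < k) mdist (c t i) (c t.+1 i).

Definition offline_opt (r : nat -> S) (T : nat) : R :=
  inf [set movement T c | c in serves r T].

(* A deterministic online algorithm maps the sequence of requests seen so far
   to the resulting positions of the servers. *)
Definition kserver_alg : Type := seq S -> 'I_k -> S.

Definition kserver_run (A : kserver_alg) (r : nat -> S) : nat -> 'I_k -> S :=
  fun t => A (mkseq r t).

Definition kserver_competitive (alpha : R) (A : kserver_alg) : Prop :=
  forall (T : nat) (r : nat -> S),
    serves r T (kserver_run A r) /\
    movement T (kserver_run A r) <= alpha * offline_opt r T.

End KServer.

Section Trajectories.
Variables (R : realType) (S : metricType R) (k : nat) (o : S).

(* part t is the index of the trajectory containing day t. *)
Definition prev_prediction (part : nat -> 'I_k) (P : nat -> S) (t : nat) : S :=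
  last o [seq P s | s <- iota 0 t & part s == part t].

Definition trajectories_cost (T : nat) (sol : nat -> S)
    (part : nat -> 'I_k) (P : nat -> S) : R :=
  \sum_(i < k) \sum_(t < T | part t == i)
    (mdist (P t) (sol t) + mdist (prev_prediction part P t) (P t)).

End Trajectories.

Section BallSearch.
Variables (R : realType) (S : metricType R) (o : S).

(* nsteps I P is the number of steps after which the search on instance I
   started from P outputs solution I. *)
Record warm_start := WarmStart {
  instance : Type;
  solution : instance -> S;
  nsteps : instance -> S -> nat;
  nsteps_le : forall I P, (nsteps I P)%:R <= mdist (solution I) P }.

(* Within a day nothing is learnt until some search outputs the solution, so
   the interleaving is a fixed sequence: the m-th step executed (m = 0, 1, ...)
   is a step of search number (schedule m).  Starting a search is free: a search
   needing 0 steps, such as one started from the solution itself, outputs the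
   solution at cost 0. *)
Record day_plan := DayPlan {
  nsearch : nat;
  source : 'I_nsearch -> S;
  schedule : nat -> 'I_nsearch }.

Definition search_steps (p : day_plan) (n : nat) (j : 'I_(nsearch p)) : nat :=
  (\sum_(m < n) (schedule p m == j))%N.

Definition found (A : warm_start) (I : instance A) (p : day_plan) (n : nat) :
    bool :=
  [exists j : 'I_(nsearch p), (nsteps I (source j) <= search_steps n j)%N].

(* The search stops, with cost n, as soon as some run outputs the solution. *)
Definition day_cost (A : warm_start) (I : instance A) (p : day_plan) (n : nat) :
    Prop :=
  found I p n /\ (forall m, (m < n)%N -> ~~ found I p m).

(* A deterministic online algorithm maps the true solutions of the past days
   to the plan of the current day; it only accesses the warm start algorithm
   by running it. *)
Definition ball_alg : Type := seq S -> day_plan.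

Definition ball_plan (B : ball_alg) (sol : nat -> S) (t : nat) : day_plan :=
  B (mkseq sol t).

(* The numbers n t are determined by day_cost; their existence says that the
   algorithm outputs the solution every day. *)
Definition ball_competitive (k : nat) (c : R) (B : ball_alg) : Prop :=
  forall (A : warm_start) (T : nat) (I : nat -> instance A),
  let sol := fun t => solution (I t) in
  exists n : nat -> nat,
    (forall t, (t < T)%N -> day_cost (I t) (ball_plan B sol t) (n t)) /\
    (forall (part : nat -> 'I_k) (P : nat -> S),
       (\sum_(t < T) n t)%N%:R <= c * trajectories_cost o T sol part P).

End BallSearch.

(* Main.v *)
Require Import Defs.
From mathcomp Require Import all_boot all_order all_algebra.
From mathcomp Require Import all_classical all_reals all_analysis.
From mathcomp Require Import lra.

Set Implicit Arguments.
Unset Strict Implicit.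
Unset Printing Implicit Defensive.

Import Order.TTheory GRing.Theory Num.Theory.

Local Open Scope ring_scope.

(** Feed the true solutions to the k-server algorithm as requests, and on each
day search round robin from the current server positions.  On day [t] the
search costs at most [k] times the distance from any server to [S_t], hence at
most [k] times the movement of the server that serves [S_t].  Conversely, [k]
trajectories yield an offline schedule in which server [i] visits the solutions
of trajectory [i]; going from one solution to the next through the predictions
shows that it costs at most twice the trajectories. *)

Section LastVisited.
Variables (X : Type) (J : eqType) (o : X) (part : nat -> J) (f : nat -> X).

Definition last_visited (t : nat) (j : J) : X :=
  last o [seq f s | s <- iota 0 t & part s == j].

Lemma last_visitedS (t : nat) (j : J) :
  last_visited t.+1 j = if part t == j then f t else last_visited t j.
Proof.
rewrite /last_visited -addn1 iotaD add0n filter_cat map_cat last_cat /=.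
by case: ifP.
Qed.

End LastVisited.

Section OfflineOptimum.
Variables (R : realType) (S : metricType R) (o : S) (k : nat).
Implicit Types (T t : nat) (r : nat -> S) (c : nat -> 'I_k -> S).

Definition config_dist (x y : 'I_k -> S) : R := \sum_(i < k) mdist (x i) (y i).

Lemma mdist_le_config_dist (x y : 'I_k -> S) (i : 'I_k) :
  mdist (x i) (y i) <= config_dist x y.
Proof.
rewrite /config_dist (bigD1 i) //= lerDl.
by apply: sumr_ge0 => j _; exact: mdist_ge0.
Qed.

Lemma movementE T c : movement T c = \sum_(t < T) config_dist (c t) (c t.+1).
Proof. by []. Qed.

Lemma movement_ge0 T c : 0 <= movement T c.
Proof. by do 2!apply: sumr_ge0 => ? _; exact: mdist_ge0. Qed.

Lemma serves_servers_gt0 T r c : serves o r T.+1 c -> (0 < k)%N.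
Proof. by move=> [_ /(_ 0%N isT) [i _]]; exact: leq_ltn_trans (ltn_ord i). Qed.

Lemma serves_mdist_le T r c t : serves o r T c -> (t < T)%N ->
  exists i, mdist (c t i) (r t) <= config_dist (c t) (c t.+1).
Proof.
move=> [_ c_serves] /c_serves[i ci]; exists i.
by rewrite -ci; exact: mdist_le_config_dist.
Qed.

Lemma serves_last_visited T r (part : nat -> 'I_k) :
  serves o r T (last_visited o part r).
Proof. by split=> // t _; exists (part t); rewrite last_visitedS eqxx. Qed.

Lemma offline_opt_le T r c :
  serves o r T c -> offline_opt k o r T <= movement T c.
Proof.
move=> rc; apply: ge_inf; last by exists c.
by exists 0 => _ [c' _ <-]; exact: movement_ge0.
Qed.

Lemma offline_opt_ge0 T r : (0 < k)%N -> 0 <= offline_opt k o r T.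
Proof.
move=> k_gt0; apply: lb_le_inf => [|_ [c _ <-]]; last exact: movement_ge0.
by eexists; exists (last_visited o (fun=> Ordinal k_gt0) r) => //;
  exact: serves_last_visited.
Qed.

End OfflineOptimum.

Section Trajectories.
Variables (R : realType) (S : metricType R) (o : S) (k : nat).
Variables (r : nat -> S) (part : nat -> 'I_k) (P : nat -> S).

Lemma prev_predictionE (t : nat) :
  prev_prediction o part P t = last_visited o part P t (part t).
Proof. by []. Qed.

(* The last distance is a potential that pays for returning from the last
   solution to the last prediction. *)
Lemma trajectory_movement_le (T : nat) (i : 'I_k) :
  \sum_(t < T) mdist (last_visited o part r t i) (last_visited o part r t.+1 i)
    + mdist (last_visited o part r T i) (last_visited o part P T i)
  <= 2 * \sum_(t < T | part t == i)
           (mdist (P t) (r t) + mdist (prev_prediction o part P t) (P t)).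
Proof.
rewrite [in leRHS]big_mkcond /=.
elim: T => [|T IHT]; first by rewrite !big_ord0 mulr0 add0r mdistxx.
rewrite !big_ord_recr /= prev_predictionE !last_visitedS.
case: eqP => [->|_]; last by rewrite mdistxx !addr0.
set x := last_visited o part r T i in IHT *.
set p := last_visited o part P T i in IHT *.
have x_to_r := metric_triangle x p (r T).
have p_to_r := metric_triangle p (P T) (r T).
have := mdist_ge0 p (P T); rewrite (metric_sym (r T) (P T)); lra.
Qed.

Lemma movement_last_visited_le (T : nat) :
  movement T (last_visited o part r) <= 2 * trajectories_cost o T r part P.
Proof.
rewrite /movement exchange_big /trajectories_cost mulr_sumr /=.
apply: ler_sum => i _; apply: le_trans (trajectory_movement_le T i).
by rewrite lerDl mdist_ge0.
Qed.

Lemma offline_opt_le_trajectories (T : nat) :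
  offline_opt k o r T <= 2 * trajectories_cost o T r part P.
Proof.
apply: le_trans (movement_last_visited_le T).
exact/offline_opt_le/serves_last_visited.
Qed.

Lemma trajectories_cost_eq0 (T : nat) :
  (forall x : S, x = o) -> trajectories_cost o T r part P = 0.
Proof.
move=> So; apply: big1 => i _; apply: big1 => t _.
by rewrite (So (P t)) (So (r t)) (So (prev_prediction _ _ _ _)) mdistxx addr0.
Qed.

End Trajectories.

Section CompetitiveRatio.
Variables (R : realType) (S : metricType R) (o : S) (k : nat) (alpha : R).
Variable A : kserver_alg S k.
Hypothesis A_competitive : kserver_competitive o alpha A.

Lemma kserver_competitive_servers_gt0 : (0 < k)%N.
Proof. by have [/serves_servers_gt0] := A_competitive 1 (fun=> o). Qed.

Lemma kserver_competitive_lt0_movement_le0 (T : nat) (r : nat -> S) :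
  alpha < 0 -> movement T (kserver_run A r) <= 0.
Proof.
move=> alpha_lt0; have [_ /le_trans] := A_competitive T r; apply.
apply: mulr_le0_ge0; first exact: ltW.
exact: (offline_opt_ge0 _ _ _ kserver_competitive_servers_gt0).
Qed.

Lemma kserver_competitive_lt0_trivial (x : S) : alpha < 0 -> x = o.
Proof.
move=> alpha_lt0; have [A_serves _] := A_competitive 1 (fun=> x).
have [i] := serves_mdist_le A_serves (ltnSn 0); rewrite A_serves.1 => ox_le.
have := kserver_competitive_lt0_movement_le0 1 (fun=> x) alpha_lt0.
rewrite movementE big_ord1 => /(le_trans ox_le) ox_le0.
by apply/esym/mdist_positivity/eqP; rewrite eq_le mdist_ge0 ox_le0.
Qed.

(* [alpha] may be negative, but then [S] is a single point. *)
Lemma kserver_competitive_le_trajectories (T : nat) (r : nat -> S)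
    (part : nat -> 'I_k) (P : nat -> S) :
  movement T (kserver_run A r) <= alpha * (2 * trajectories_cost o T r part P).
Proof.
have [alpha_ge0|alpha_lt0] := leP 0 alpha.
  have [_ /le_trans] := A_competitive T r; apply.
  exact/ler_wpM2l/offline_opt_le_trajectories.
rewrite trajectories_cost_eq0 => [|x].
  by rewrite !mulr0; exact: kserver_competitive_lt0_movement_le0.
exact: kserver_competitive_lt0_trivial.
Qed.

End CompetitiveRatio.

Section DayCost.
Variables (R : realType) (S : metricType R) (W : warm_start S).
Variables (I : instance W) (p : day_plan S).

Lemma found_day_cost (n : nat) : found I p n -> exists m, day_cost I p m.
Proof.
move=> found_n; have [m found_m m_min] := ex_minnP (ex_intro _ n found_n).
by exists m; split=> // l; rewrite ltnNge; apply: contra => /m_min.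
Qed.

Lemma day_cost_le_found (n m : nat) :
  day_cost I p n -> found I p m -> (n <= m)%N.
Proof.
by move=> [_ n_min]; apply: contraTT; rewrite -ltnNge => /n_min.
Qed.

End DayCost.

Lemma sum_inZp_eq (k q : nat) (j : 'I_k.+1) :
  (\sum_(m < q * k.+1) (inZp m == j :> 'I_k.+1) = q)%N.
Proof.
elim: q => [|q IHq]; first by rewrite big_ord0.
rewrite mulSn addnC big_split_ord /= IHq -[RHS]addn1; congr (_ + _)%N.
rewrite (bigD1 j) //= big1 ?addn0 => [|i /negPf i_neq_j].
  by rewrite -val_eqE /= modnMDl modn_small ?eqxx.
by rewrite -val_eqE /= modnMDl modn_small // val_eqE i_neq_j.
Qed.

Section RoundRobin.
Variables (R : realType) (S : metricType R) (k : nat).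

Definition round_robin (src : 'I_k.+1 -> S) : day_plan S :=
  DayPlan src (fun m => inZp m).

Variables (W : warm_start S) (I : instance W) (src : 'I_k.+1 -> S).

Lemma found_round_robin (j : 'I_k.+1) :
  found I (round_robin src) (nsteps I (src j) * k.+1).
Proof. by apply/existsP; exists j; rewrite /search_steps sum_inZp_eq. Qed.

Lemma day_cost_round_robin_exists : exists n, day_cost I (round_robin src) n.
Proof. exact: found_day_cost (found_round_robin ord0). Qed.

Lemma day_cost_round_robin_le (n : nat) (j : 'I_k.+1) :
  day_cost I (round_robin src) n ->
  n%:R <= k.+1%:R * mdist (src j) (solution I).
Proof.
move=> /day_cost_le_found/(_ (found_round_robin j)); rewrite -(ler_nat R).
move=> /le_trans; apply.
by rewrite natrM mulrC ler_pM2l ?ltr0n // metric_sym nsteps_le.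
Qed.

End RoundRobin.

Section RoundRobinBallSearch.
Variables (R : realType) (S : metricType R) (o : S) (k : nat).
Variable A : kserver_alg S k.+1.

Definition round_robin_ball_alg : ball_alg S :=
  fun past => round_robin (A past).

Lemma sum_day_cost_le_movement (W : warm_start S) (T : nat)
    (I : nat -> instance W) (n : nat -> nat) (sol := fun t => solution (I t)) :
  serves o sol T (kserver_run A sol) ->
  (forall t, (t < T)%N ->
     day_cost (I t) (ball_plan round_robin_ball_alg sol t) (n t)) ->
  (\sum_(t < T) n t)%N%:R <= k.+1%:R * movement T (kserver_run A sol).
Proof.
move=> A_serves n_cost; rewrite natr_sum movementE mulr_sumr.
apply: ler_sum => t _; have [i Ai_le] := serves_mdist_le A_serves (ltn_ord t).
apply: le_trans (day_cost_round_robin_le i (n_cost t (ltn_ord t))) _.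
by rewrite ler_pM2l ?ltr0n.
Qed.

Lemma round_robin_ball_competitive (alpha : R) :
  kserver_competitive o alpha A ->
  ball_competitive o k.+1 (2 * (k.+1%:R * alpha)) round_robin_ball_alg.
Proof.
move=> A_competitive W T I sol.
have [n n_cost] :=
  choice (fun t => day_cost_round_robin_exists (I t) (A (mkseq sol t))).
exists n; split=> [t _|part P]; first exact: n_cost.
have [A_serves _] := A_competitive T sol.
apply: le_trans (sum_day_cost_le_movement A_serves (fun t _ => n_cost t)) _.
rewrite mulrCA -!mulrA ler_pM2l ?ltr0n // mulrCA.
exact: kserver_competitive_le_trajectories.
Qed.

End RoundRobinBallSearch.

Theorem theorem5p6 :
  exists C : nat,
  forall (R : realType) (S : metricType R) (o : S) (k : nat) (alpha : R)
         (A : kserver_alg S k),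
    kserver_competitive o alpha A ->
  exists B : ball_alg S,
    (forall past : seq S, (nsearch (B past) <= k)%N) /\
    ball_competitive o k (C%:R * (k%:R * alpha)) B.
Proof.
exists 2%N => R S o [|k] alpha A A_competitive.
  by have := kserver_competitive_servers_gt0 A_competitive.
exists (round_robin_ball_alg A); split=> //.
exact: round_robin_ball_competitive.
Qed.
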